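(* Let $\mathcal{G}=\langle\mathcal{H},\mathcal{E}\rangle$ be a quantum Markov chain, let $T_{\mathcal{E}}=\mathcal{E}_\infty(\mathcal{H})^\perp$, and let $$\mathcal{H}=B_1\oplus\cdots\oplus B_u\oplus T_{\mathcal{E}}=D_1\oplus\cdots\oplus D_v\oplus T_{\mathcal{E}}$$ be two decompositions in which the $B_i$ are pairwise orthogonal bottom strongly connected components (BSCCs) of $\mathcal{G}$ and the $D_i$ are pairwise orthogonal BSCCs of $\mathcal{G}$ (all of them orthogonal to $T_{\mathcal{E}}$), where the $B_i$'s and the $D_i$'s are each arranged in increasing (non-decreasing) order of dimension. Then $u=v$, and $\dim(B_i)=\dim(D_i)$ for each $1\le i\le u$.
   Context: $\mathcal{H}$ is a (nonzero) finite-dimensional complex Hilbert space. A density operator is a positive semidefinite operator of trace $1$; a pure state is a unit vector $|\psi\rangle$, and $\psi=|\psi\rangle\langle\psi|$. $\mathrm{supp}(\rho)$ is the span of the eigenvectors of $\rho$ with nonzero eigenvalue. $\bigvee$ denotes the span of a union of subspaces, $P_X$ the orthogonal projection onto $X$. A quantum Markov chain is a pair $\langle\mathcal{H},\mathcal{E}\rangle$ with $\mathcal{E}$ a trace-preserving completely positive linear map on the operators on $\mathcal{H}$. For a completely positive map $\mathcal{F}$ and a subspace $X$, the image is $\mathcal{F}(X)=\bigvee_{|\psi\rangle\in X}\mathrm{supp}(\mathcal{F}(\psi))$. $X$ is invariant if $\mathcal{E}(X)\subseteq X$. For a chain $\langle\mathcal{K},\mathcal{F}\rangle$ ($\mathcal{F}$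 completely positive and trace-nonincreasing on $\mathcal{K}$), a path is a sequence of density operators $\rho_0\to\cdots\to\rho_n$, $n\ge 0$, with $\mathrm{supp}(\rho_{i+1})\subseteq\mathcal{F}(\mathrm{supp}(\rho_i))$. For a pure state $|\psi\rangle$, $\mathcal{R}_{\langle\mathcal{K},\mathcal{F}\rangle}(\psi)$ is the span of all pure states $|\varphi\rangle$ such that there is a path from $\psi$ to $\varphi$; equivalently $\bigvee_{i\ge 0}\mathrm{supp}(\mathcal{F}^i(\psi))$. The restriction to $X$ is $\mathcal{G}_X=\langle X,\mathcal{E}|_X\rangle$ with $\mathcal{E}|_X(\rho)=P_X\mathcal{E}(\rho)P_X$. $X$ is strongly connected if $|\varphi\rangle\in\mathcal{R}_{\mathcal{G}_X}(\psi)$ and $|\psi\rangle\in\mathcal{R}_{\mathcal{G}_X}(\varphi)$ for all pure states $|\varphi\rangle,|\psi\rangle\in X$. An SCC is a $\subseteq$-maximal strongly connected subspace; a BSCC is an invariant SCC. The asymptotic average of $\mathcal{E}$ is $\mathcal{E}_\infty=\lim_{N\to\infty}\frac1N\sum_{n=1}^N\mathcal{E}^n$ (the limit exists and is again a trace-preserving completely positive map). *)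

(* Defs.v *)
From mathcomp Require Import all_boot all_order all_algebra.
From mathcomp Require Import all_classical all_reals topology normedtype.

Set Implicit Arguments.
Unset Strict Implicit.
Unset Printing Implicit Defensive.

Import Order.TTheory GRing.Theory Num.Theory numFieldNormedType.Exports.

Local Open Scope classical_set_scope.
Local Open Scope sesquilinear_scope.
Local Open Scope ring_scope.

(* The Hilbert space of dimension n is 'rV[C]_n with the inner product dotmx
   (linear in its first argument).  As everywhere in MathComp, vectors are rows
   and operators act on the right: A : 'M[C]_n stands for v |-> v *m A.  A
   subspace is the row space of a matrix, so subspaces are compared by
   (_ <= _)%MS, and never by Leibniz equality; its dimension is \rank. *)

(* The same term as the local notation of the same name in spectral.v. *)
Notation "B ^!" :=
  (orthomx Num.conj (mx_of_hermitian (hermitian1mx _)) B) : matrix_set_scope.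
Notation "A '_|_ B" := (A%MS <= B^!)%MS : bool_scope.

(* The span of the union of a set of subspaces (or, for m = 1, the span of a
   set of vectors): the smallest subspace containing all of them.  It exists by
   bigveeP. *)
Definition bigvee (C : fieldType) (m n : nat)
    (S : set 'M[C]_(m, n)) : 'M[C]_n :=
  xget 0 [set U : 'M[C]_n |
    forall V : 'M[C]_n, (U <= V)%MS <-> (forall A, S A -> (A <= V)%MS)].

Lemma bigveeP (C : fieldType) (m n : nat) (S : set 'M[C]_(m, n)) (V : 'M[C]_n) :
  (bigvee S <= V)%MS <-> (forall A, S A -> (A <= V)%MS).
Proof.
rewrite /bigvee; case: xgetP => [U _ -> //|noU].
pose ub (W : 'M[C]_n) := forall A, S A -> (A <= W)%MS.
pose P k := `[< exists2 W, ub W & \rank W = k >].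
have exP : exists k, P k.
  by exists (\rank (1%:M : 'M[C]_n)); apply/asboolP; exists 1%:M => // A _;
    rewrite submx1.
case: (ex_minnP exP) => k /asboolP [U ubU <-] minU.
exfalso; apply: (noU U) => W; split=> [sUW A /ubU sAU|ubW].
  exact: submx_trans sUW.
have ubUW : ub (U :&: W)%MS by move=> A SA; rewrite sub_capmx ubU ?ubW.
have : (\rank U <= \rank (U :&: W)%MS)%N.
  by apply: minU; apply/asboolP; exists (U :&: W)%MS.
rewrite (geq_leqif (mxrank_leqif_sup (capmxSl U W))) => sU.
exact: submx_trans sU (capmxSr U W).
Qed.

Section QuantumMarkovChain.
Context (C : numClosedFieldType).

Definition psd (n : nat) (A : 'M[C]_n) : Prop :=
  A \is hermsymmx /\ forall v : 'rV[C]_n, 0 <= dotmx (v *m A) v.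

Definition density (n : nat) (A : 'M[C]_n) : Prop := psd A /\ \tr A = 1.

Definition pure_states (n : nat) (X : 'M[C]_n) : set 'rV[C]_n :=
  [set psi | (psi <= X)%MS /\ dotmx psi psi = 1].

(* |psi><psi|, that is v |-> dotmx v psi *: psi. *)
Definition ketbra (n : nat) (psi : 'rV[C]_n) : 'M[C]_n := psi^t* *m psi.

Definition supp (n : nat) (A : 'M[C]_n) : 'M[C]_n :=
  bigvee [set eigenspace A a | a in [set a : C | a != 0]].

(* An operator on C^k (x) C^n is a k x k block matrix with blocks in 'M[C]_n,
   on which id (x) F acts blockwise. *)
Definition completely_positive (n : nat) (F : 'M[C]_n -> 'M[C]_n) : Prop :=
  forall (k : nat) (A : 'I_k -> 'I_k -> 'M[C]_n),
    psd (\mxblock_(i < k, j < k) A i j) ->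
    psd (\mxblock_(i < k, j < k) F (A i j)).

Definition trace_preserving (n : nat) (F : 'M[C]_n -> 'M[C]_n) : Prop :=
  forall A, \tr (F A) = \tr A.

Definition quantum_markov_chain (n : nat)
    (E : {linear 'M[C]_n -> 'M[C]_n}) : Prop :=
  completely_positive E /\ trace_preserving E.

Definition chain_image (n : nat) (F : 'M[C]_n -> 'M[C]_n)
    (X : 'M[C]_n) : 'M[C]_n :=
  bigvee [set supp (F (ketbra psi)) | psi in pure_states X].

Definition invariant_subspace (n : nat) (E : 'M[C]_n -> 'M[C]_n)
    (X : 'M[C]_n) : Prop :=
  (chain_image E X <= X)%MS.

(* A chain <K, F> on a subspace K of 'rV[C]_n is given by K and a map F on
   'M[C]_n; the operators on K are those of 'M[C]_n with support in K. *)
Definition path_between (n : nat) (K : 'M[C]_n) (F : 'M[C]_n -> 'M[C]_n)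
    (rho sigma : 'M[C]_n) : Prop :=
  exists (m : nat) (r : nat -> 'M[C]_n),
    [/\ r 0%N = rho,
        r m = sigma,
        forall i, (i <= m)%N -> density (r i) /\ (supp (r i) <= K)%MS
      & forall i, (i < m)%N -> (supp (r i.+1) <= chain_image F (supp (r i)))%MS].

Definition reachable (n : nat) (K : 'M[C]_n) (F : 'M[C]_n -> 'M[C]_n)
    (psi : 'rV[C]_n) : 'M[C]_n :=
  bigvee [set phi | pure_states K phi
                    /\ path_between K F (ketbra psi) (ketbra phi)].

Definition restriction (n : nat) (E : 'M[C]_n -> 'M[C]_n) (X : 'M[C]_n) :
    'M[C]_n -> 'M[C]_n :=
  fun rho => proj_ortho X *m E rho *m proj_ortho X.

Definition strongly_connected (n : nat) (E : 'M[C]_n -> 'M[C]_n)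
    (X : 'M[C]_n) : Prop :=
  forall phi psi, pure_states X phi -> pure_states X psi ->
    (phi <= reachable X (restriction E X) psi)%MS
    /\ (psi <= reachable X (restriction E X) phi)%MS.

Definition scc (n : nat) (E : 'M[C]_n -> 'M[C]_n) (X : 'M[C]_n) : Prop :=
  strongly_connected E X
  /\ forall Y, strongly_connected E Y -> (X <= Y)%MS -> (Y <= X)%MS.

Definition bscc (n : nat) (E : 'M[C]_n -> 'M[C]_n) (X : 'M[C]_n) : Prop :=
  scc E X /\ invariant_subspace E X.

(* lim is total, but these means do converge when E is a quantum Markov chain. *)
Definition asymptotic_average (n : nat) (E : 'M[C]_n -> 'M[C]_n)
    (A : 'M[C]_n) : 'M[C]_n :=
  lim ((fun N : nat => (N%:R^-1 : C) *: \sum_(1 <= k < N.+1) iter k E A) @ \oo).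

Definition transient_subspace (n : nat) (E : 'M[C]_n -> 'M[C]_n) : 'M[C]_n :=
  ((chain_image (asymptotic_average E) 1%:M)^!)%MS.

Definition bscc_decomposition (n : nat) (E : 'M[C]_n -> 'M[C]_n)
    (u : nat) (B : 'I_u -> 'M[C]_n) : Prop :=
  [/\ forall i, bscc E (B i),
      forall i j, i != j -> (B i '_|_ B j),
      forall i, (B i '_|_ transient_subspace E),
      mxdirect (\sum_(i < u) B i + transient_subspace E)
    & (\sum_(i < u) B i + transient_subspace E == 1%:M)%MS].

End QuantumMarkovChain.

(* Main.v *)
(* Invariant subspaces are closed under intersections and, because E is positive
   and supp A <= supp M for psd operators A <= M, under sums.  A BSCC is a
   minimal nonzero invariant subspace, since what is reachable from a vector of
   an invariant subspace stays inside it.  Both decompositions write the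
   orthogonal complement of the transient subspace as a direct sum of atoms of
   this modular lattice, and Steinitz exchange (as in Krull-Schmidt) shows that
   the multiset of dimensions of the atoms is unique. *)
Require Import Defs.
From mathcomp Require Import all_boot all_order all_algebra.
From mathcomp Require Import all_classical all_reals topology normedtype.
From mathcomp.real_closed Require Import complex.
From mathcomp Require Import ring.

Local Open Scope complex_scope.
Local Open Scope ring_scope.

Set Implicit Arguments.
Unset Strict Implicit.
Unset Printing Implicit Defensive.

Import Order.TTheory GRing.Theory Num.Theory.
Local Open Scope sesquilinear_scope.

(** * Exchange of atoms in a lattice of subspaces *)

Section AtomsOfSubspaceLattice.
Context (F : fieldType) (n : nat) (L : 'M[F]_n -> Prop).

Definition atom (X : 'M[F]_n) : Prop :=
  [/\ L X, X != 0
    & forall Y : 'M[F]_n, L Y -> (Y <= X)%MS -> Y = 0 \/ (X <= Y)%MS].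

(** Directness of the sum of [U] and the members of [s], as a rank equation, which is convenient for
    induction on lists. *)
Definition indep_over (U : 'M[F]_n) (s : seq 'M[F]_n) : Prop :=
  \rank (U + \sum_(b <- s) b)%MS = (\rank U + \sum_(b <- s) \rank b)%N.

(** Rank is subadditive, so equality for the whole sum forces equality in each partial sum. *)
Lemma indep_over_cons (U b : 'M[F]_n) (s : seq 'M[F]_n) :
  indep_over U (b :: s) ->
  \rank (U + b)%MS = (\rank U + \rank b)%N /\ indep_over (U + b)%MS s.
Proof.
rewrite /indep_over !big_cons addsmxA addnA => rkUbs.
have leUb : (\rank (U + b)%MS <= \rank U + \rank b)%N.
  by apply: mxrank_adds_leqif.
have les : (\rank (\sum_(c <- s) c)%MS <= \sum_(c <- s) \rank c)%N.
  elim: (s) => [|c r IHr]; first by rewrite !big_nil mxrank0.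
  rewrite !big_cons; apply: leq_trans (leq_add (leqnn _) IHr).
  by apply: mxrank_adds_leqif.
have rkUb : \rank (U + b)%MS = (\rank U + \rank b)%N.
  apply/eqP; rewrite eqn_leq leUb -(leq_add2r (\sum_(c <- s) \rank c)) -rkUbs.
  apply: leq_trans (leq_add (leqnn _) les).
  by apply: mxrank_adds_leqif.
by rewrite rkUbs rkUb.
Qed.

Hypothesis L_adds : forall X Y, L X -> L Y -> L (X + Y)%MS.
Hypothesis L_cap : forall X Y, L X -> L Y -> L (X :&: Y)%MS.

(** By minimality [X :&: U] is either [0], and the dimension formula applies, or all of [X]. *)
Lemma atomP (X U : 'M[F]_n) : atom X -> L U ->
  \rank (U + X)%MS = (\rank U + \rank X)%N \/ (X <= U)%MS.
Proof.
move=> [LX _ minX] LU.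
have [X0|] := minX _ (L_cap LX LU) (capmxSl X U).
  by left; rewrite addsmxC addnC -mxrank_sum_cap X0 mxrank0 addn0.
by rewrite sub_capmx => /andP[_]; right.
Qed.

(* Grow U by the elements of s one at a time: the first b for which U + b
   contains D can be traded for D, because U + b = U + D. *)
Lemma atom_exchange (s : seq 'M[F]_n) (U D : 'M[F]_n) :
    L U -> (forall b, b \in s -> atom b) -> atom D ->
    indep_over U s -> \rank (U + D)%MS = (\rank U + \rank D)%N ->
    (D <= U + \sum_(b <- s) b)%MS ->
  exists r : seq 'M[F]_n,
    [/\ forall b, b \in r -> atom b,
        perm_eq (map mxrank s) (\rank D :: map mxrank r)
      & (U + D + \sum_(b <- r) b :=: U + \sum_(b <- s) b)%MS].
Proof.
elim: s U => [|b s IHs] U LU atoms atomD indep rkUD sDU.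
  have [_ /negP[]] := atomD; rewrite -mxrank_eq0 -(eqn_add2l (\rank U)) -rkUD.
  by move: sDU; rewrite big_nil addsmx0 => /addsmx_idPl ->; rewrite addn0.
have atomb : atom b by apply: atoms; rewrite mem_head.
have [Lb b0 _] := atomb; have [LD D0 _] := atomD.
have [rkUb indep'] := indep_over_cons indep.
(* As long as [D] is independent of [U + b], keep [b] and continue over [U + b]; otherwise [b] is
   the member to trade. *)
have [rkUbD|sDUb] := atomP atomD (L_adds LU Lb).
  have [|||r [atomr permr eqr]] := IHs (U + b)%MS _ _ atomD indep' rkUbD.
  - exact: L_adds.
  - by move=> c sc; apply: atoms; rewrite in_cons sc orbT.
  - by rewrite -addsmxA; rewrite big_cons in sDU.
  exists (b :: r); split.
  - by move=> c; rewrite in_cons => /orP[/eqP->|/atomr].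
  - rewrite /=; apply: (@perm_trans _ [:: \rank b, \rank D & map mxrank r]).
      by rewrite perm_cons.
    exact: (permEl (perm_catCA [:: \rank b] [:: \rank D] _)).
  - rewrite !big_cons !addsmxA -(addsmxA U D) (addsmxC D) addsmxA.
    exact: eqr.
(* If [b] were independent of [U + D], then [U + D + b], which lies in [U + b], would exceed it in
   rank by [\rank D]. *)
have [rkUDb|sbUD] := atomP atomb (L_adds LU LD).
  have : (\rank (U + D + b)%MS <= \rank (U + b)%MS)%N.
    by apply: mxrankS; rewrite !addsmx_sub addsmxSl sDUb addsmxSr.
  by rewrite rkUDb rkUD rkUb leq_add2r -[X in (_ <= X)%N]addn0 leq_add2l leqn0
    mxrank_eq0 (negPf D0).
have eqUDb : (U + D :=: U + b)%MS.
  by apply/eqmxP; rewrite !addsmx_sub !addsmxSl sDUb sbUD.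
exists s; split.
- by move=> c sc; apply: atoms; rewrite in_cons sc orbT.
- rewrite /=; suff -> : \rank b = \rank D by [].
  by apply/eqP; rewrite -(eqn_add2l (\rank U)) -rkUb -rkUD eqUDb.
- rewrite big_cons addsmxA; exact: adds_eqmx.
Qed.

(** Induction on [t]: exchange its head [D] into [s], absorb [D] into the base [U], and compare what
    remains. The base stands in for passing to a quotient. *)
Lemma atom_ranks_unique (t s : seq 'M[F]_n) (U : 'M[F]_n) :
    L U -> (forall b, b \in s -> atom b) -> (forall b, b \in t -> atom b) ->
    indep_over U s -> indep_over U t ->
    (U + \sum_(b <- s) b :=: U + \sum_(b <- t) b)%MS ->
  perm_eq (map mxrank s) (map mxrank t).
Proof.
elim: t s U => [|D t IHt] s U LU atoms atomt indeps indept eqst.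
  (* With [t] empty the ranks in [s] add up to [0], which excludes any atom. *)
  case: s atoms indeps eqst => [//|b s] atoms.
  rewrite /indep_over => rks eqs; move: rks.
  rewrite eqs big_nil addsmx0 -[LHS]addn0 => /addnI /esym/eqP.
  rewrite big_cons addn_eq0 mxrank_eq0.
  by have [_ /negPf -> _] := atoms b (mem_head _ _).
have atomD : atom D by apply: atomt; rewrite mem_head.
have [rkUD indept'] := indep_over_cons indept.
have [|r [atomr permr eqr]] := atom_exchange LU atoms atomD indeps rkUD.
  by rewrite eqst big_cons addsmxA (submx_trans _ (addsmxSl _ _)) ?addsmxSr.
rewrite /=; apply: (perm_trans permr); rewrite perm_cons.
apply: (IHt _ (U + D)%MS) => //.
- by apply: L_adds => //; case: atomD.
- by move=> c tc; apply: atomt; rewrite in_cons tc orbT.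
(* The exchange preserves both the total subspace and the multiset of ranks, hence also
   independence. *)
- rewrite /indep_over eqr indeps rkUD -addnA; congr addn.
  rewrite -(big_map mxrank xpredT id) (perm_big _ permr).
  by rewrite big_cons big_map.
- apply: eqmx_trans eqr _; apply: eqmx_trans eqst _.
  by rewrite big_cons addsmxA; exact: eqmx_refl.
Qed.

End AtomsOfSubspaceLattice.

(** [codom] lists the values in index order, and two sorted lists that are permutations of each
    other are equal. *)
Lemma perm_eq_nondecreasing (u v : nat) (f : 'I_u -> nat) (g : 'I_v -> nat) :
    (forall i j : 'I_u, (i <= j)%N -> (f i <= f j)%N) ->
    (forall i j : 'I_v, (i <= j)%N -> (g i <= g j)%N) ->
    perm_eq (codom f) (codom g) ->
  exists eq_uv : u = v, forall i : 'I_u, f i = g (cast_ord eq_uv i).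
Proof.
have codom_sorted w (h : 'I_w -> nat) :
    (forall i j : 'I_w, (i <= j)%N -> (h i <= h j)%N) -> sorted leq (codom h).
  move=> h_homo; rewrite codomE sorted_map; apply: (@sub_sorted _ (relpre val leq)).
    by move=> i j /=; apply: h_homo.
  by rewrite -sorted_map val_enum_ord iota_sorted.
move=> /codom_sorted fs /codom_sorted gs fg.
have eqfg : codom f = codom g by apply: (sorted_eq leq_trans anti_leq).
have eq_uv : u = v.
  by have := congr1 size eqfg; rewrite !size_codom !card_ord.
exists eq_uv => i; case: _ / eq_uv g {gs fg} eqfg => g.
rewrite cast_ord_id !codomE => /eq_in_map; apply; exact: mem_enum.
Qed.

(** * Supports of positive semidefinite operators *)

Section Supports.
Context (C : numClosedFieldType) (n : nat).
Implicit Types (A M X Y : 'M[C]_n) (u v w : 'rV[C]_n).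

Lemma hermsymmxP A : reflect (A^t* = A) (A \is hermsymmx).
Proof.
by apply: (iffP (is_hermitianmxP _ _ _)); rewrite expr0 scale1r => /esym.
Qed.

Lemma dotmx_mull A u v : dotmx (u *m A) v = dotmx u (v *m A^t*).
Proof.
by rewrite !dotmxE trmx_mul map_mxM -[(A^t*)^t*]/((A^t*)^t*) trmxCK mulmxA.
Qed.

Lemma psd_dotmx_eq0 A v : psd A -> dotmx (v *m A) v = 0 -> v *m A = 0.
Proof.
move=> [/hermsymmxP hA posA] vAv.
set y := v *m A; set a := dotmx y y; set c := dotmx (y *m A) y.
have a_ge0 : 0 <= a by rewrite /a dnorm_ge0.
have c_ge0 : 0 <= c by apply: posA.
apply/eqP; rewrite -(dnorm_eq0 (@dotmx C n)) -/a.
(* The parabola s |-> q (v - s y) = s^2 c - 2 s a is negative for small s > 0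
   unless a = 0; s = a / (c + 1) is small enough. *)
have ineq s : 0 <= s -> 0 <= s * (s * c - a *+ 2).
  move=> s_ge0; have := posA (v - s *: y).
  rewrite mulmxBl -scalemxAl -/y.
  rewrite linearBl /= !linearBr /= vAv.
  rewrite !linearZl_LR /= !linearZr_LR /= (geC0_conj s_ge0).
  have -> : dotmx (y *m A) v = a by rewrite dotmx_mull hA.
  by rewrite -/a -/c; congr (0 <= _); ring.
have c1_gt0 : 0 < c + 1 by rewrite ltr_wpDl.
have := ineq (a / (c + 1)) (divr_ge0 a_ge0 (ltW c1_gt0)).
have -> : a / (c + 1) * (a / (c + 1) * c - a *+ 2) =
    - (a ^+ 2 * ((c + 2) / (c + 1) ^+ 2)).
  by field; rewrite gt_eqF.
rewrite oppr_ge0 => le0; have k_gt0 : 0 < (c + 2) / (c + 1) ^+ 2.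
  by rewrite divr_gt0 ?exprn_gt0 // ltr_wpDl.
by move: le0; rewrite pmulr_lle0 // real_exprn_even_le0 ?ger0_real.
Qed.

(** A vector killed by [M] has zero quadratic form under [A], so [A] kills it too. For Hermitian
    matrices this inclusion of kernels dualizes to the reverse inclusion of row spaces. *)
Lemma psd_mono_submx A M : psd A -> psd (M - A) -> M \is hermsymmx ->
  (A <= M)%MS.
Proof.
move=> psdA [_ posMA] /hermsymmxP hM; rewrite submxE.
have hA : A^t* = A by apply/hermsymmxP; case: psdA.
have kerA : (kermx M <= kermx A)%MS.
  apply/rV_subP => v /sub_kermxP vM; apply/sub_kermxP.
  apply: (psd_dotmx_eq0 psdA); apply/eqP; rewrite eq_le; case: (psdA) => _ -> /=.
  by rewrite andbT -oppr_ge0; have := posMA v; rewrite mulmxBr vM sub0r linearNl.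
(* Since [M] is Hermitian, the adjoint of its cokernel lies in its kernel, hence in that of [A]. *)
have : (cokermx M)^t* *m A = 0.
  apply/sub_kermxP; apply: submx_trans kerA; apply/sub_kermxP.
  by rewrite -[X in _ *m X]hM -map_mxM -trmx_mul mulmx_coker trmx0 map_mx0.
move/(congr1 (fun X => X^t*)); rewrite trmx_mul map_mxM hA trmxCK => ->.
by rewrite trmx0 map_mx0.
Qed.

Lemma supp_subP A X :
  (supp A <= X)%MS <-> (forall a, a != 0 -> (eigenspace A a <= X)%MS).
Proof.
rewrite /supp; split=> [/bigveeP sAX a a0|sAX]; first by apply: sAX; exists a.
by apply/bigveeP => _ [a a0 <-]; apply: sAX.
Qed.

Lemma supp_submx A : (supp A <= A)%MS.
Proof.
apply/supp_subP => a a0; have /eigenspaceP eA := submx_refl (eigenspace A a).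
by rewrite -(eqmx_scale _ a0) -eA submxMl.
Qed.

(** Diagonalize: [A] is spanned by the rows of the spectral basis with nonzero eigenvalue. With
    [supp_submx], the support becomes interchangeable with the row space. *)
Lemma sub_supp A : psd A -> (A <= supp A)%MS.
Proof.
move=> [/hermitian_normalmx/orthomx_spectralP eqA _].
set P := spectralmx A in eqA; set d := spectral_diag A in eqA.
have row_diag i : row i (diag_mx d *m P) = d 0 i *: row i P.
  by rewrite row_mul row_diag_mx -scalemxAl -rowE.
rewrite [X in (X <= _)%MS]eqA -mulmxA mulmx_sub //.
apply/row_subP => i; rewrite row_diag.
have [->|di0] := eqVneq (d 0 i) 0; first by rewrite scale0r sub0mx.
have := (@supp_subP A (supp A)).1 (submx_refl _) _ di0.
apply: submx_trans; apply/scalemx_sub/eigenspaceP.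
by rewrite eqA -row_mul !mulmxA mulmxV ?spectral_unit // mul1mx row_diag.
Qed.

Lemma psd_ketbra v : psd (ketbra v).
Proof.
rewrite /ketbra; split=> [|w].
  by apply/hermsymmxP; rewrite trmx_mul map_mxM trmxCK.
rewrite mulmxA [w *m _]mx11_scalar -dotmxE mul_scalar_mx linearZl_LR /=.
by rewrite [dotmx v w]hermC /= expr0 mul1r mul_conjC_ge0.
Qed.

Lemma ketbra_supp v : dotmx v v = 1 -> (v <= supp (ketbra v))%MS.
Proof.
move=> v1; apply: submx_trans (sub_supp (psd_ketbra v)).
have eqv : v *m ketbra v = v.
  by rewrite mulmxA [v *m _]mx11_scalar -dotmxE v1 mul1mx.
by rewrite -[X in (X <= _)%MS]eqv submxMl.
Qed.

Lemma supp_ketbra v : (supp (ketbra v) <= v)%MS.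
Proof. exact: submx_trans (supp_submx _) (submxMl _ _). Qed.

Lemma ketbraZ (c : C) v : ketbra (c *: v) = `|c| ^+ 2 *: ketbra v.
Proof.
rewrite /ketbra -scalemxAr linearZ /= map_mxZ -scalemxAl scalerA.
by rewrite normCK.
Qed.

Lemma ketbra_parallelogram u v :
  ketbra (u + v) + ketbra (u - v) = 2 *: (ketbra u + ketbra v).
Proof.
apply/matrixP => i j; rewrite /ketbra !mxE !big_ord1 !mxE.
by rewrite rmorphD rmorphB /=; ring.
Qed.

Lemma normalize_vector v : v != 0 ->
  exists2 c : C, c != 0 & dotmx (c *: v) (c *: v) = 1.
Proof.
move=> v0; have v_gt0 : 0 < dotmx v v by rewrite dnorm_gt0.
exists (sqrtC (dotmx v v))^-1; first by rewrite invr_eq0 sqrtC_eq0 gt_eqF.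
rewrite (@dnormZ _ _ (@dotmx C n)) normfV ger0_norm ?sqrtC_ge0 ?(ltW v_gt0) //.
by rewrite exprVn sqrtCK mulVf ?gt_eqF.
Qed.

Lemma pure_states_span X Y :
  (forall v, pure_states X v -> (v <= Y)%MS) -> (X <= Y)%MS.
Proof.
move=> XY; apply/rV_subP => v vX.
have [->|/normalize_vector[c c0 cv1]] := eqVneq v 0; first exact: sub0mx.
by rewrite -(eqmx_scale v c0) XY //; split=> //; apply: scalemx_sub.
Qed.

End Supports.

Lemma psd_castmx (C : numClosedFieldType) (m n : nat) (eq_mn : m = n)
    (A : 'M[C]_m) : psd (castmx (eq_mn, eq_mn) A) <-> psd A.
Proof. by case: _ / eq_mn. Qed.

(** Serves to read complete positivity at [k = 1] as plain positivity. The cast is needed because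
    the two sizes are only provably equal. *)
Lemma mxblock1 (T : Type) (n : nat) (eq_n : n = (\sum_(i < 1) n)%N)
    (A : 'M[T]_n) : \mxblock_(i < 1, j < 1) A = castmx (eq_n, eq_n) A.
Proof.
have sig2E (p : 'I_(\sum_(i < 1) n)%N) : tagnat.sig2 p = p :> nat.
  by rewrite [RHS]tagnat.rect big1 // => i; rewrite [tagnat.sig1 p]ord1.
apply/matrixP => i j; rewrite castmxE mxE.
by congr (A _ _); apply/val_inj; rewrite /= sig2E.
Qed.

(** * Invariant subspaces and BSCCs of a completely positive map *)

Section InvariantSubspaces.
Context (C : numClosedFieldType) (n : nat) (E : {linear 'M[C]_n -> 'M[C]_n}).
Hypothesis cpE : completely_positive E.
Implicit Types (A X Y : 'M[C]_n) (v : 'rV[C]_n).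

Lemma completely_positive_psd A : psd A -> psd (E A).
Proof.
have eq_n : n = (\sum_(i < 1) n)%N by rewrite big_ord1.
move=> psdA; have := @cpE 1 (fun _ _ => A).
by rewrite !(mxblock1 eq_n) => /(_ ((psd_castmx _ _).2 psdA)) /psd_castmx.
Qed.

Lemma psd_ketbra_image v : psd (E (ketbra v)).
Proof. exact/completely_positive_psd/psd_ketbra. Qed.

(** Removes normalization and supports from the definition: rescaling [v] multiplies [E (ketbra v)]
    by a nonzero scalar, and a psd operator has its support as row space. *)
Lemma invariant_subspaceP X :
  invariant_subspace E X <-> forall v, (v <= X)%MS -> (E (ketbra v) <= X)%MS.
Proof.
split=> [/bigveeP invX v vX|invX]; last first.
  apply/bigveeP => _ [v [vX _] <-]; apply: submx_trans (invX v vX).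
  exact: supp_submx.
have [->|/normalize_vector[c c0 cv1]] := eqVneq v 0.
  by rewrite /ketbra mulmx0 linear0 sub0mx.
have c2 : `|c| ^+ 2 != 0 by rewrite expf_eq0 normr_eq0.
rewrite -(eqmx_scale _ c2) -linearZ -ketbraZ.
apply: submx_trans (sub_supp (psd_ketbra_image _)) _.
apply: invX; exists (c *: v) => //; split=> //; exact: scalemx_sub.
Qed.

Lemma invariant_cap X Y : invariant_subspace E X -> invariant_subspace E Y ->
  invariant_subspace E (X :&: Y)%MS.
Proof.
move=> /invariant_subspaceP invX /invariant_subspaceP invY.
apply/invariant_subspaceP => v; rewrite !sub_capmx => /andP[vX vY].
by rewrite invX ?invY.
Qed.

(* By the parallelogram law, E(|x+y><x+y|) <= 2 E(|x><x|) + 2 E(|y><y|). *)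
Lemma invariant_adds X Y : invariant_subspace E X -> invariant_subspace E Y ->
  invariant_subspace E (X + Y)%MS.
Proof.
move=> /invariant_subspaceP invX /invariant_subspaceP invY.
apply/invariant_subspaceP => v /sub_addsmxP[[a b] /= ->].
set x := a *m X; set y := b *m Y.
pose M := 2 *: (E (ketbra x) + E (ketbra y)).
have eqM : E (ketbra (x + y)) + E (ketbra (x - y)) = M.
  by rewrite -linearD ketbra_parallelogram linearZ linearD.
have [hermD posD] := psd_ketbra_image (x - y).
have [/hermsymmxP hermx _] := psd_ketbra_image x.
have [/hermsymmxP hermy _] := psd_ketbra_image y.
have hermM : M \is hermsymmx.
  apply/hermsymmxP; rewrite /M linearZ /= map_mxZ linearD /= map_mxD.
  by rewrite hermx hermy rmorph_nat.
(* The difference [M - E (ketbra (x + y))] is [E (ketbra (x - y))], which is psd. *)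
apply: (submx_trans (psd_mono_submx (psd_ketbra_image _) _ hermM)).
  by rewrite -eqM addrC addKr; split.
by rewrite /M scalemx_sub // addmx_sub_adds ?invX ?invY ?submxMl.
Qed.

Lemma reachable_sub_invariant X Y v : invariant_subspace E Y -> (Y <= X)%MS ->
  (v <= Y)%MS -> (reachable X (restriction E X) v <= Y)%MS.
Proof.
move=> /invariant_subspaceP invY YX vY.
apply/bigveeP => w [[_ w1] [m [r [r0 rm _ step]]]].
suff rY i : (i <= m)%N -> (supp (r i) <= Y)%MS.
  by have := rY m (leqnn m); rewrite rm; apply: submx_trans; exact: ketbra_supp.
elim: i => [_|i IHi lt_im].
  by rewrite r0; apply: submx_trans vY; exact: supp_ketbra.
apply: submx_trans (step i lt_im) _; apply/bigveeP => _ [u [ui _] <-].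
(* The left projection can only shrink the row space, and the right one fixes rows lying in [Y],
   hence in [X]. *)
apply: submx_trans (supp_submx _) _; rewrite /restriction -mulmxA mulmx_sub //.
have EuY : (E (ketbra u) <= Y)%MS.
  by apply: invY; apply: submx_trans ui (IHi (ltnW lt_im)).
by rewrite proj_ortho_id // (submx_trans EuY).
Qed.

(** Pure states of a line are proportional, so paths of length [0] suffice. This is what keeps a
    maximal strongly connected subspace from being [0]. *)
Lemma strongly_connected_line v : strongly_connected E <<v>>%MS.
Proof.
suff refl u w : pure_states <<v>>%MS u -> pure_states <<v>>%MS w ->
    (u <= reachable <<v>>%MS (restriction E <<v>>%MS) w)%MS.
  by move=> u w uv wv; split; apply: refl.
move=> [uv u1] [wv w1]; rewrite genmxE in uv; rewrite genmxE in wv.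
have uw : (u <= w)%MS.
  have /sub_rVP[c wE] := wv; rewrite wE; rewrite wE in w1.
  rewrite (eqmx_scale v) //; apply: contra_eq_neq w1 => ->.
  by rewrite scale0r linear0l eq_sym oner_eq0.
apply: submx_trans uw _.
apply: ((@bigveeP _ _ _ _ _).1 (submx_refl _)); split.
  by split; rewrite ?genmxE.
exists 0%N, (fun=> ketbra w); split=> // i _; split.
  split; first exact: psd_ketbra.
  by rewrite /ketbra mxtrace_mulC [w *m _]mx11_scalar -dotmxE w1 mxtrace1.
by rewrite genmxE (submx_trans (supp_ketbra w)).
Qed.

Lemma bscc_atom X : (0 < n)%N -> bscc E X -> atom (invariant_subspace E) X.
Proof.
move=> n_gt0 [[scX maxX] invX]; split=> // [|Y invY YX].
  (* A zero [X] would lie strictly below the line of the all-ones vector, nonzero because [0 < n],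
     against maximality. *)
  apply/eqP => X0; pose e : 'rV[C]_n := const_mx 1.
  have := maxX _ (@strongly_connected_line e); rewrite X0 sub0mx => /(_ isT).
  rewrite submx0 => /eqP/(congr1 mxrank)/eqP; rewrite mxrank0 mxrank_gen.
  rewrite mxrank_eq0 => /eqP/rowP/(_ (Ordinal n_gt0))/eqP.
  by rewrite !mxE oner_eq0.
(* Every pure state of [X] is reachable from a unit vector of [Y], and reachability cannot leave
   [Y]. *)
have [->|/rowV0Pn[v vY v0]] := eqVneq Y 0; [by left|right].
have [c c0 cv1] := normalize_vector v0; have cvY := scalemx_sub c vY.
apply: pure_states_span => w wX.
have [wr _] := scX w (c *: v) wX (conj (submx_trans cvY YX) cv1).
exact: submx_trans wr (reachable_sub_invariant invY YX cvY).
Qed.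

(** Identifies the sum of the components with a subspace that depends on [E] alone, so that two
    decompositions can be compared. *)
Lemma bscc_decomposition_sum (u : nat) (B : 'I_u -> 'M[C]_n) :
    bscc_decomposition E B ->
  (\sum_(i < u) B i :=: (transient_subspace E)^!)%MS /\
  \rank (\sum_(i < u) B i)%MS = (\sum_(i < u) \rank (B i))%N.
Proof.
move=> [_ _ orthBT dirBT /eqmxP BT1].
set T := transient_subspace E in orthBT dirBT BT1 *.
set S := (\sum_(i < u) B i)%MS in dirBT BT1 *.
have ST : (S <= T^!)%MS by apply/sumsmx_subP => i _; apply: orthBT.
split; last first.
  by move: dirBT; rewrite mxdirect_addsE /= => /and3P[/mxdirectP].
apply/eqmxP; rewrite ST /=.
have : (T^! <= T^! :&: (S + T))%MS by rewrite sub_capmx submx_refl BT1 submx1.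
move/submx_trans; apply.
(* Modular law: as [S <= T^!], intersecting [S + T] with [T^!] gives [S + (T :&: T^!)], which is
   [S]. *)
rewrite capmxC -matrix_modl //.
by rewrite addsmx_sub submx_refl orthomx_ortho_disj sub0mx.
Qed.

End InvariantSubspaces.

Theorem theorem6 (R : realType) (n : nat) (n_gt0 : (0 < n)%N)
    (E : {linear 'M[R[i]]_n -> 'M[R[i]]_n}) (hE : quantum_markov_chain E)
    (u v : nat) (B : 'I_u -> 'M[R[i]]_n) (D : 'I_v -> 'M[R[i]]_n)
    (hB : bscc_decomposition E B) (hD : bscc_decomposition E D)
    (dimB : forall i j : 'I_u, (i <= j)%N -> (\rank (B i) <= \rank (B j))%N)
    (dimD : forall i j : 'I_v, (i <= j)%N -> (\rank (D i) <= \rank (D j))%N) :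
  exists eq_uv : u = v,
    forall i : 'I_u, \rank (B i) = \rank (D (cast_ord eq_uv i)).
Proof.
have [cpE _] := hE.
have [sumB rkB] := bscc_decomposition_sum hB.
have [sumD rkD] := bscc_decomposition_sum hD.
have atoms w (X : 'I_w -> 'M[R[i]]_n) : bscc_decomposition E X ->
    forall Y, Y \in codom X -> atom (invariant_subspace E) Y.
  by move=> [bsccX _ _ _ _] _ /codomP[k ->]; apply: bscc_atom.
have sumE w (X : 'I_w -> 'M[R[i]]_n) :
    (\sum_(Y <- codom X) Y = \sum_(k < w) X k)%MS.
  by rewrite codomE big_map big_enum.
have indep w (X : 'I_w -> 'M[R[i]]_n) :
    \rank (\sum_(k < w) X k)%MS = (\sum_(k < w) \rank (X k))%N ->
    indep_over 0 (codom X).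
  rewrite /indep_over sumE adds0mx mxrank0 => ->.
  by rewrite codomE big_map big_enum.
apply: perm_eq_nondecreasing dimB dimD _.
have codom_rank w (X : 'I_w -> 'M[R[i]]_n) :
    codom (fun k => \rank (X k)) = map mxrank (codom X).
  by rewrite (codomE X) -map_comp codomE.
rewrite !codom_rank.
(* The exchange starts from the zero subspace, which is itself invariant. *)
apply: (@atom_ranks_unique _ _ (invariant_subspace E) _ _ _ _ 0).
- exact: invariant_adds.
- exact: invariant_cap.
- apply/(invariant_subspaceP cpE) => x; rewrite submx0 => /eqP ->.
  by rewrite /ketbra mulmx0 linear0 sub0mx.
- exact: atoms.
- exact: atoms.
- exact: indep.
- exact: indep.
- apply: eqmx_trans (adds0mx _ _) _; apply: eqmx_sym.
  apply: eqmx_trans (adds0mx _ _) _; rewrite !sumE.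
  exact: eqmx_trans sumD (eqmx_sym sumB).
Qed.
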